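(* For all terms $a,b,c$ of the language of £: (1) $\Vdash^M \mathcal T(a=b)\vee\mathcal T(a\neq b)$; (2) $\Vdash^M a=a$; (3) $\Vdash^M a=b\wedge b=c\to a=c$; (4) $\Vdash^M a=b\to b=a$; (5) $\Vdash^M a=b\to(A^a_v\to A^b_v)$ for every formula $A$ and variable $v$ such that $a$ and $b$ are substitutable for $v$ in $A$.
   Context: The language of the librationist theory £: variables; primitive set constants $\mathcal T$ (the truth set) and $\mathcal F$; atomic formulas $a\in b$; formulas $\downarrow AB$ (joint denial) and $\forall vA$; terms $\{v\mid A\}$; name terms $\ulcorner X\urcorner$ for expressions $X$. $\neg A:=\downarrow AA$, other connectives and $\exists$ defined classically; $\mathcal TA$ abbreviates $\ulcorner A\urcorner\in\mathcal T$. Identity is defined (co-essentiality): $a=b:\equiv\forall u(a\in u\to b\in u)$, and $a\neq b:\equiv\neg a=b$. Semantics: for each $n\in\omega$ and ordinal $\alpha$ a full set $\models^\alpha_n$ of formulas ($\downarrow AB\in\models^\alpha_n$ iff neither $A$ nor $B$ is in it; $\forall vA\in\models^\alpha_n$ iff $A^b_v\in\models^\alpha_n$ for all substitutable terms $b$); $(\models^0_n)_n$ a fixed enumeration of full sets; for $\alpha>0$, $\mathcal TA\in\models^\alpha_n$ iff for some $\gamma<\alpha$, $A\in\models^\delta_n$ for all $\gamma\le\delta<\alpha$, and $a\in\{x\mid A\}\in\models^\alpha_n$ iff $\mathcal TA^a_x\in\models^\alpha_n$. $\models^\alpha B$ iff $B\in\models^\alpha_n$ for all $n$. $\mathrm{IN}^\alpha(A)$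 iff $\models^\beta\mathcal TA$ for all $\beta\ge\alpha$; $\mathrm{IN}(A)$ iff $\exists\alpha\,\mathrm{IN}^\alpha(A)$; $\alpha$ stabilizes $A$ iff ($\mathrm{IN}(A)\Rightarrow\mathrm{IN}^\alpha(A)$) and ($\models^\alpha\mathcal TA\Rightarrow\mathrm{IN}(A)$); the closure ordinal $\varpi$ is the least ordinal stabilizing every sentence. $\Vdash^M A$ ($A$ is a maxim) iff $\mathcal TA\in\models^\varpi_n$ for all $n$. *)

(* Defs.v *)
From mathcomp Require Import all_boot.

Set Implicit Arguments.
Unset Strict Implicit.
Unset Printing Implicit Defensive.

(** * Syntax *)

Inductive term : Type :=
  | tVar of nat
  | tT
  | tF
  | tCompr of nat & formula      (* { v | A } *)
  | tName of expression          (* quotation name of an expression *)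
with formula : Type :=
  | fMem of term & term
  | fNor of formula & formula    (* joint denial *)
  | fAll of nat & formula
with expression : Type :=
  | ETerm of term
  | EForm of formula.

Definition fNot (A : formula) : formula := fNor A A.
Definition fOr (A B : formula) : formula := fNot (fNor A B).
Definition fAnd (A B : formula) : formula := fNor (fNot A) (fNot B).
Definition fImp (A B : formula) : formula := fOr (fNot A) B.

Definition fTr (A : formula) : formula := fMem (tName (EForm A)) tT.

(* Names are quotations, hence closed: a variable of X is neither free in, nor
   replaced by substitution inside, the name of X. *)
Fixpoint fv_term (t : term) : seq nat :=
  match t with
  | tVar w => [:: w]
  | tCompr w A => [seq x <- fv_form A | x != w]
  | tT | tF | tName _ => [::]
  end
with fv_form (A : formula) : seq nat :=
  match A with
  | fMem s t => fv_term s ++ fv_term t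
  | fNor B C => fv_form B ++ fv_form C
  | fAll w B => [seq x <- fv_form B | x != w]
  end.

Definition sentence (A : formula) : bool := nilp (fv_form A).

(* [subst_form v a A] is A^a_v; it does not rename bound variables, so it is
   meaningful only together with [substitutable]. *)
Fixpoint subst_term (v : nat) (a : term) (t : term) : term :=
  match t with
  | tVar w => if w == v then a else tVar w
  | tCompr w A => if w == v then tCompr w A else tCompr w (subst_form v a A)
  | tT | tF | tName _ => t
  end
with subst_form (v : nat) (a : term) (A : formula) : formula :=
  match A with
  | fMem s t => fMem (subst_term v a s) (subst_term v a t)
  | fNor B C => fNor (subst_form v a B) (subst_form v a C)
  | fAll w B => if w == v then fAll w B else fAll w (subst_form v a B)
  end.

Fixpoint substitutable_term (a : term) (v : nat) (t : term) : bool :=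
  match t with
  | tCompr w A => (v \notin fv_term t) ||
                 ((w \notin fv_term a) && substitutable a v A)
  | tVar _ | tT | tF | tName _ => true
  end
with substitutable (a : term) (v : nat) (A : formula) : bool :=
  match A with
  | fMem s t => substitutable_term a v s && substitutable_term a v t
  | fNor B C => substitutable a v B && substitutable a v C
  | fAll w B => (v \notin fv_form A) ||
               ((w \notin fv_term a) && substitutable a v B)
  end.

Definition fresh (a b : term) : nat :=
  (\max_(x <- fv_term a ++ fv_term b) x).+1.

(* a = b, i.e. forall u (a \in u -> b \in u), with u not free in a, b *)
Definition fEq (a b : term) : formula :=
  let u := fresh a b in fAll u (fImp (fMem a (tVar u)) (fMem b (tVar u))).
Definition fNeq (a b : term) : formula := fNot (fEq a b).

(** * Ordinals *)

(* Set-like trees: [Osup f] denotes the least ordinal strictly above every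
   [f i].  Every ordinal has many representing trees; equality of ordinals
   is [oeq]. *)
Inductive ord : Type := Osup (K : Type) of K -> ord.

Fixpoint ole (x y : ord) : Prop :=
  match x, y with
  | Osup _ f, Osup _ g => forall i, exists j, ole (f i) (g j)
  end.
Definition olt (x y : ord) : Prop :=
  match y with Osup _ g => exists j, ole x (g j) end.
Definition oeq (x y : ord) : Prop := ole x y /\ ole y x.
Definition ozero : ord := Osup (fun e : Empty_set => match e with end).

(** * Semantics *)

Definition full (S : formula -> Prop) : Prop :=
  (forall A B, S (fNor A B) <-> ~ S A /\ ~ S B) /\
  (forall v A, S (fAll v A) <->
     forall b, substitutable b v A -> S (subst_form v b A)).

(* [sat M alpha n A] says that A belongs to |=^alpha_n.  The initial full sets
   |=^0_n are arbitrary.  Atoms not governed by the two clauses for positive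
   ordinals (e.g. a \in tF, or a \in tT with a not the name of a formula)
   are left unconstrained. *)
Record semantics : Type := Semantics {
  sat : ord -> nat -> formula -> Prop;
  sat_oeq : forall alpha beta n A,
    oeq alpha beta -> sat alpha n A -> sat beta n A;
  sat_full : forall alpha n, full (sat alpha n);
  sat_Tr : forall alpha n A, olt ozero alpha ->
    sat alpha n (fTr A) <->
    exists2 gamma, olt gamma alpha &
      forall delta, ole gamma delta -> olt delta alpha -> sat delta n A;
  sat_Compr : forall alpha n a x A, olt ozero alpha -> substitutable a x A ->
    sat alpha n (fMem a (tCompr x A)) <-> sat alpha n (fTr (subst_form x a A))
}.

Definition valid (M : semantics) (alpha : ord) (A : formula) : Prop :=
  forall n, sat M alpha n A.

Definition IN_from (M : semantics) (alpha : ord) (A : formula) : Prop :=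
  forall beta, ole alpha beta -> valid M beta (fTr A).

Definition IN (M : semantics) (A : formula) : Prop :=
  exists alpha, IN_from M alpha A.

Definition stabilizes (M : semantics) (alpha : ord) (A : formula) : Prop :=
  (IN M A -> IN_from M alpha A) /\ (valid M alpha (fTr A) -> IN M A).

Definition stabilizes_all (M : semantics) (alpha : ord) : Prop :=
  forall A, sentence A -> stabilizes M alpha A.

Definition closure_ordinal (M : semantics) (varpi : ord) : Prop :=
  stabilizes_all M varpi /\ forall beta, stabilizes_all M beta -> ole varpi beta.

Definition maxim (M : semantics) (varpi : ord) (A : formula) : Prop :=
  forall n, sat M varpi n (fTr A).

(* Main.v *)
Require Import Defs.
From mathcomp Require Import all_boot.
From Stdlib Require Import Classical ClassicalEpsilon.

(** Applying a = b to the set {x | a = x} shows that a = b at stage beta forces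
    a = b at a final stretch of earlier stages, hence, by well-foundedness, at
    all earlier stages.  So for each n, a = b either holds at every stage or
    fails from some stage on; as n ranges over a countable set, one stage alpha
    is past all these failures, and a = b at any stage beta >= alpha gives
    a = b at stage beta + 1.  There a = b applied to {v | A} compares the truth
    values of A^a_v and A^b_v at stage beta.  All five formulas therefore hold
    at every sufficiently large stage. *)

(** * Ordinals *)

Lemma ole_refl x : ole x x.
Proof. by elim: x => K f IH /= i; exists i; apply: IH. Qed.

Lemma ole_trans y x z : ole x y -> ole y z -> ole x z.
Proof.
elim: y x z => K g IH [I f] [J h] /= fg gh i.
have [j fij] := fg i; have [k gjk] := gh j.
by exists k; apply: IH fij gjk.
Qed.

Lemma olt_ole_trans {x y z} : olt x y -> ole y z -> olt x z.
Proof.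
case: y z => K g [J h] /= [j xgj] /(_ j) [k gjk].
by exists k; apply: ole_trans gjk.
Qed.

Lemma ole_olt_trans {x y z} : ole x y -> olt y z -> olt x z.
Proof. by case: z => J h /= xy [k yk]; exists k; apply: ole_trans yk. Qed.

Lemma ole_Osup K (f : K -> ord) z : (forall i, olt (f i) z) -> ole (Osup f) z.
Proof. by case: z. Qed.

Lemma olt_Osup {K} (f : K -> ord) i : olt (f i) (Osup f).
Proof. by exists i; apply: ole_refl. Qed.

Lemma olt_ole {x y} : olt x y -> ole x y.
Proof.
elim: x y => K f IH [J g] [j fgj] /= i.
exists j; apply: IH; exact: olt_ole_trans (olt_Osup f i) fgj.
Qed.

(** If [ole] fails, classically some [f i] lies below no [g j]; by induction every [g j] is then
    strictly below that [f i], which bounds [Osup g]. *)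
Lemma ole_or_olt x y : ole x y \/ olt y x.
Proof.
elim: x y => K f IH [J g].
have [?|/not_all_ex_not [i Hi]] := classic (ole (Osup f) (Osup g)); first by left.
right; exists i; apply: ole_Osup => j.
by have [fgij|//] := IH i (g j); case: Hi; exists j.
Qed.

Lemma olt_wf_ind (P : ord -> Prop) :
  (forall x, (forall y, olt y x -> P y) -> P x) -> forall x, P x.
Proof.
(* Ordinals below [x] need not be subtrees of [x], only bounded by one, so the structural induction
   must cover all [y] with [ole y x]. *)
move=> step x; suff: forall y, ole y x -> P y by apply; apply: ole_refl.
elim: x => K f IH y yx; apply: step => z zy.
have [i zfi] := olt_ole_trans zy yx; exact: IH zfi.
Qed.

Definition osucc (x : ord) : ord := Osup (fun _ : unit => x).

Lemma olt_osucc x : olt x (osucc x).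
Proof. by exists tt; apply: ole_refl. Qed.

Lemma olt_osuccE x y : olt x (osucc y) -> ole x y.
Proof. by case. Qed.

Lemma ozero_le x : ole ozero x.
Proof. by apply: ole_Osup; case. Qed.

Lemma ozero_lt {x y} : olt x y -> olt ozero y.
Proof. exact/ole_olt_trans/ozero_le. Qed.

(** * Substitution *)

Lemma subst_term_id v a t : v \notin fv_term t -> subst_term v a t = t
with subst_form_id v a A : v \notin fv_form A -> subst_form v a A = A.
Proof.
- case: t => [w|||w A|X] //=.
    by rewrite inE eq_sym => /negbTE ->.
  case: eqP => // /eqP wv; rewrite mem_filter eq_sym wv /= => vA.
  by rewrite subst_form_id.
- case: A => [s t|B C|w B] /=.
  + by rewrite mem_cat => /norP[vs vt]; rewrite !subst_term_id.
  + by rewrite mem_cat => /norP[vB vC]; rewrite !subst_form_id.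
  + case: eqP => // /eqP wv; rewrite mem_filter eq_sym wv /= => vB.
    by rewrite subst_form_id.
Qed.

Lemma substitutable_term_notin a v t :
  v \notin fv_term t -> substitutable_term a v t.
Proof. by case: t => //= w A ->. Qed.

Lemma fresh_bound {a b : term} x :
  x \in fv_term a ++ fv_term b -> x < fresh a b.
Proof. by move=> xab; rewrite ltnS; apply: leq_bigmax_seq. Qed.

Lemma notin_fresh (a b : term) u : fresh a b <= u ->
  (u \notin fv_term a) /\ (u \notin fv_term b).
Proof.
move=> le_u; apply/andP; rewrite -negb_or -mem_cat.
by apply/negP=> /fresh_bound; rewrite ltnNge le_u.
Qed.

(** * Full sets *)

Section Full.

Variables (S : formula -> Prop) (Sfull : full S).

Lemma full_not A : S (fNot A) <-> ~ S A.
Proof. by have := Sfull.1 A A; rewrite /fNot; tauto. Qed.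

Lemma full_or A B : S (fOr A B) <-> S A \/ S B.
Proof. by have := Sfull.1 A B; have := full_not (fNor A B); rewrite /fOr; tauto. Qed.

Lemma full_and A B : S (fAnd A B) <-> S A /\ S B.
Proof.
have := Sfull.1 (fNot A) (fNot B); have := full_not A; have := full_not B.
rewrite /fAnd; tauto.
Qed.

Lemma full_imp A B : S (fImp A B) <-> (S A -> S B).
Proof. by have := full_or (fNot A) B; have := full_not A; rewrite /fImp; tauto. Qed.

(** The bound variable is left arbitrary because the substitution instances below, such as a = a,
    need not bind the one that [fresh] picks. *)
Lemma full_coessential a b u : u \notin fv_term a -> u \notin fv_term b ->
  S (fAll u (fImp (fMem a (tVar u)) (fMem b (tVar u)))) <->
  forall d, S (fMem a d) -> S (fMem b d).
Proof.
move=> ua ub; rewrite Sfull.2.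
have subE d : subst_form u d (fImp (fMem a (tVar u)) (fMem b (tVar u)))
    = fImp (fMem a d) (fMem b d) by rewrite /= eqxx !subst_term_id.
split=> [H d|H d _]; last by rewrite subE; apply/full_imp/H.
by apply/full_imp; rewrite -subE; apply: H; rewrite /= !substitutable_term_notin.
Qed.

Lemma full_eq a b : S (fEq a b) <-> forall d, S (fMem a d) -> S (fMem b d).
Proof. by have [ua ub] := notin_fresh a b _ (leqnn _); apply: full_coessential. Qed.

End Full.

(** * Stages *)

Section Stages.

Variable M : semantics.

(** Every final stretch below [osucc beta] contains [beta], and the one starting at [beta] contains
    only ordinals equal to it. *)
Lemma sat_Tr_succ beta n A : sat M (osucc beta) n (fTr A) <-> sat M beta n A.
Proof.
have pos := ozero_lt (olt_osucc beta).
split=> [/(sat_Tr _ _ _ pos)[gamma /olt_osuccE gb H]|Ab].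
  exact: H gb (olt_osucc beta).
apply/(sat_Tr _ _ _ pos); exists beta; first exact: olt_osucc.
by move=> delta bd /olt_osuccE db; apply: sat_oeq Ab.
Qed.

Lemma sat_eq_Tr_subst beta n a b v A : olt ozero beta ->
    substitutable a v A -> substitutable b v A -> sat M beta n (fEq a b) ->
  sat M beta n (fTr (subst_form v a A)) -> sat M beta n (fTr (subst_form v b A)).
Proof.
move=> pos aA bA /(full_eq _ (sat_full _ _ _)) ab Aa.
by apply/(sat_Compr _ _ pos bA)/ab/(sat_Compr _ _ pos aA).
Qed.

Lemma sat_eq_Tr beta n a b :
  olt ozero beta -> sat M beta n (fEq a b) -> sat M beta n (fTr (fEq a b)).
Proof.
move=> pos ab; pose u := fresh a b.
have [ua ub] := notin_fresh a b u (leqnn _).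
have [xa xb] := notin_fresh a b u.+1 (leqnSn _).
(* This says a = x with x the variable [u.+1]. Binding [u], rather than the variable of
   [fEq a (tVar u.+1)], makes the instance at [b] literally [fEq a b]. *)
pose A := fAll u (fImp (fMem a (tVar u)) (fMem (tVar u.+1) (tVar u))).
have ux : (u == u.+1) = false by apply/negbTE; rewrite neq_ltn leqnn.
have subE d : subst_form u.+1 d A
    = fAll u (fImp (fMem a (tVar u)) (fMem d (tVar u))).
  by rewrite /= ux eqxx /= !subst_term_id //= ux.
have okA d : u \notin fv_term d -> substitutable d u.+1 A.
  by move=> ud; rewrite /= ud !substitutable_term_notin // orbT.
have -> : fEq a b = subst_form u.+1 b A by rewrite subE.
(* It remains to show the truth of the instance at [a], a form of a = a, which holds at every
   stage. *)
apply: (sat_eq_Tr_subst _ _ a) => //; try exact: okA.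
apply/(sat_Tr _ _ _ pos); exists ozero => // delta _ _.
by rewrite subE; apply/(full_coessential _ (sat_full _ _ _)).
Qed.

Lemma sat_eq_downward beta n a b : sat M beta n (fEq a b) ->
  forall delta, ole delta beta -> sat M delta n (fEq a b).
Proof.
elim/olt_wf_ind: beta => beta IH ab delta db.
have [bd|ltdb] := ole_or_olt beta delta; first by apply: sat_oeq ab.
have pos := ozero_lt ltdb.
have [gamma gb H] := (sat_Tr _ _ _ pos).1 (sat_eq_Tr _ _ _ _ pos ab).
(* Stages from [gamma] on lie in the final stretch; earlier ones are reached by induction from
   [gamma], where a = b also holds. *)
have [gd|dg] := ole_or_olt gamma delta; first exact: H.
by apply: (IH gamma gb) (olt_ole dg); apply: H (ole_refl _) gb.
Qed.

Lemma eq_decided a b : exists alpha, forall beta n, ole alpha beta ->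
  sat M beta n (fEq a b) -> forall delta, sat M delta n (fEq a b).
Proof.
have dec n : exists gamma,
    sat M gamma n (fEq a b) -> forall delta, sat M delta n (fEq a b).
  have [?|/not_all_ex_not [gamma ?]] :=
    classic (forall delta, sat M delta n (fEq a b)); first by exists ozero.
  by exists gamma.
(* Choose for each [n] a stage where a = b fails, if there is one; truth at any stage past it would
   descend to it. *)
pose g n := proj1_sig (constructive_indefinite_description _ (dec n)).
exists (Osup g) => beta n gb ab.
apply: (proj2_sig (constructive_indefinite_description _ (dec n))).
apply: sat_eq_downward ab _ _; exact: olt_ole (olt_ole_trans (olt_Osup g n) gb).
Qed.

Lemma eq_subst_eventually a b v A :
    substitutable a v A -> substitutable b v A ->
  exists alpha, forall beta, ole alpha beta ->
    valid M beta (fImp (fEq a b) (fImp (subst_form v a A) (subst_form v b A))).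
Proof.
move=> aA bA; have [alpha H] := eq_decided a b.
exists alpha => beta le_ab n; apply/full_imp => [|ab]; first exact: sat_full.
(* Both instances are moved to [osucc beta], which is positive even when [beta] is zero, so the
   comprehension clause applies. *)
apply/full_imp => [|/sat_Tr_succ Aa]; first exact: sat_full.
apply/sat_Tr_succ; apply: sat_eq_Tr_subst Aa => //.
  exact: ozero_lt (olt_osucc beta).
exact: H ab _.
Qed.

(** Substitution is applied to x = a, whose instance at [a] holds by reflexivity and whose instance
    at [b] is [fEq b a]. *)
Lemma eq_sym_eventually a b : exists alpha, forall beta, ole alpha beta ->
  valid M beta (fImp (fEq a b) (fEq b a)).
Proof.
pose u := fresh b a.
have [ub ua] := notin_fresh b a u (leqnn _).
have [xb xa] := notin_fresh b a u.+1 (leqnSn _).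
pose A := fAll u (fImp (fMem (tVar u.+1) (tVar u)) (fMem a (tVar u))).
have ux : (u == u.+1) = false by apply/negbTE; rewrite neq_ltn leqnn.
have subE d : subst_form u.+1 d A
    = fAll u (fImp (fMem d (tVar u)) (fMem a (tVar u))).
  by rewrite /= ux eqxx /= !subst_term_id //= ux.
have okA d : u \notin fv_term d -> substitutable d u.+1 A.
  by move=> ud; rewrite /= ud !substitutable_term_notin // orbT.
have [alpha H] := eq_subst_eventually _ _ _ _ (okA a ua) (okA b ub).
exists alpha => beta le_ab n; have := H beta le_ab n.
have F := sat_full M beta n; rewrite !subE => /(full_imp _ F) Hab.
apply/(full_imp _ F) => /Hab/(full_imp _ F); apply.
exact/(full_coessential _ F).
Qed.

Lemma eq_Tr_eventually a b : exists alpha, forall beta, ole alpha beta ->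
  valid M beta (fOr (fTr (fEq a b)) (fTr (fNeq a b))).
Proof.
have [alpha H] := eq_decided a b.
(* The successor puts [alpha] strictly below [beta], so that a final stretch may start at
   [alpha]. *)
exists (osucc alpha) => beta le_ab n; apply/full_or; first exact: sat_full.
have lt_ab := olt_ole_trans (olt_osucc alpha) le_ab.
have pos := ozero_lt lt_ab.
have [allE|nallE] := classic (forall delta, sat M delta n (fEq a b)).
  by left; apply/(sat_Tr _ _ _ pos); exists ozero.
right; apply/(sat_Tr _ _ _ pos); exists alpha => // delta le_ad _.
by apply/full_not => [|ab]; [apply: sat_full | apply/nallE/(H delta)].
Qed.

(* A may be open, whereas varpi only stabilizes sentences; but T A is a
   sentence, since names are closed, and T (T A) at varpi + 1 gives T A at
   varpi.  This also covers varpi = 0, where [sat_Tr] says nothing. *)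
Lemma maxim_eventually varpi A : stabilizes_all M varpi ->
    (exists alpha, forall beta, ole alpha beta -> valid M beta A) ->
  maxim M varpi A.
Proof.
move=> stab [alpha H] n.
have TA delta : olt alpha delta -> valid M delta (fTr A).
  move=> ad m; apply/sat_Tr; first exact: ozero_lt ad.
  by exists alpha => // eps ae _; apply: H.
have INTA : IN M (fTr A).
  exists (osucc (osucc alpha)) => beta le_b m.
  have lt_b := olt_ole_trans (olt_osucc _) le_b.
  apply/sat_Tr; first exact: ozero_lt lt_b.
  exists (osucc alpha) => // delta le_d _.
  exact: TA (olt_ole_trans (olt_osucc alpha) le_d) m.
apply/sat_Tr_succ/((stab (fTr A) isT).1 INTA).
exact: olt_ole (olt_osucc varpi).
Qed.

End Stages.

Theorem theorem8p3p1 (M : semantics) (varpi : ord)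
    (hvarpi : closure_ordinal M varpi) (a b c : term) :
  maxim M varpi (fOr (fTr (fEq a b)) (fTr (fNeq a b))) /\
  maxim M varpi (fEq a a) /\
  maxim M varpi (fImp (fAnd (fEq a b) (fEq b c)) (fEq a c)) /\
  maxim M varpi (fImp (fEq a b) (fEq b a)) /\
  (forall (A : formula) (v : nat),
     substitutable a v A -> substitutable b v A ->
     maxim M varpi
       (fImp (fEq a b) (fImp (subst_form v a A) (subst_form v b A)))).
Proof.
have max A := maxim_eventually M varpi A hvarpi.1.
split; first exact/max/eq_Tr_eventually.
split.
  (* Reflexivity, and transitivity after it, hold in every full set, hence from stage zero on. *)
  by apply: max; exists ozero => beta _ n; apply/(full_eq _ (sat_full _ _ _)).
split.
  apply: max; exists ozero => beta _ n; have F := sat_full M beta n.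
  apply/(full_imp _ F) => /(full_and _ F)[/(full_eq _ F) ab /(full_eq _ F) bc].
  by apply/(full_eq _ F) => d /ab/bc.
split; first exact/max/eq_sym_eventually.
by move=> A v aA bA; apply/max/eq_subst_eventually.
Qed.
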